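(* Let $n\geq 1$ be an integer. The Sieradski group $S(2,n)$ is a LOG group if and only if $6\mid n$.
   Context: The Sieradski group $S(2,n)$ is the group with presentation $\langle x_0,\ldots,x_{n-1}\mid x_ix_{i+2}x_{i+1}^{-1}\ (0\leq i<n)\rangle$, subscripts taken modulo $n$. A Labelled Oriented Graph (LOG) consists of a finite graph (possibly with loops and multiple edges) with vertex set $V$ and edge set $E$, together with three maps $\iota,\tau,\lambda:E\to V$, called the initial vertex map, terminal vertex map, and labelling map, respectively. The LOG determines a corresponding LOG presentation $\langle V\mid \tau(e)^{-1}\lambda(e)^{-1}\iota(e)\lambda(e)\ (e\in E)\rangle$. A LOG group is a group with a LOG presentation. *)

(* Defs.v *)
From HB Require Import structures.
From mathcomp Require Import all_boot.
From mathcomp Require Import boolp.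

Set Implicit Arguments.
Unset Strict Implicit.
Unset Printing Implicit Defensive.

(* Words in the letters x^{+1}, x^{-1}: the letter (x, true) stands for x^{-1}
   and (x, false) for x.  Words are not assumed to be freely reduced. *)
Definition word (X : Type) := seq (X * bool).

Definition wgen (X : Type) (x : X) : word X := [:: (x, false)].

Definition winv (X : Type) (w : word X) : word X :=
  rev [seq (a.1, ~~ a.2) | a <- w].

Section Presentation.

Variables (X : choiceType) (I : Type) (r : I -> word X).

(* The smallest congruence on words containing free cancellation and
   r i ~ 1 for all i. *)
Inductive word_eqv : word X -> word X -> Prop :=
| WRefl u : word_eqv u u
| WSym u v : word_eqv u v -> word_eqv v u
| WTrans u v w : word_eqv u v -> word_eqv v w -> word_eqv u w
| WCat u u' v v' :
    word_eqv u u' -> word_eqv v v' -> word_eqv (u ++ v) (u' ++ v')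
| WCancel x b : word_eqv [:: (x, b); (x, ~~ b)] [::]
| WRel i : word_eqv (r i) [::].

Definition word_eqvb : rel (word X) := fun u v => `[< word_eqv u v >].

Lemma word_eqvb_refl : reflexive word_eqvb.
Proof. by move=> u; apply/asboolP/WRefl. Qed.

Lemma word_eqvb_sym : symmetric word_eqvb.
Proof. by move=> u v; apply/asboolP/asboolP; apply: WSym. Qed.

Lemma word_eqvb_trans : transitive word_eqvb.
Proof.
by move=> v u w /asboolP uv /asboolP vw; apply/asboolP/(WTrans uv vw).
Qed.

Canonical word_equiv :=
  EquivRel word_eqvb word_eqvb_refl word_eqvb_sym word_eqvb_trans.

(* The group < X | r i (i : I) >. *)
Definition presented_group := {eq_quot word_equiv}%qT.

HB.instance Definition _ := Choice.on presented_group.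
HB.instance Definition _ := EqQuotient.on presented_group.

Local Notation pi := (\pi_presented_group)%qT.

Lemma pi_eqP u v : pi u = pi v <-> word_eqv u v.
Proof.
split=> [/eqquotP/asboolP //|uv].
by apply/eqquotP/asboolP.
Qed.

Lemma repr_pi u : word_eqv (repr (pi u)) u.
Proof. by apply/pi_eqP; rewrite reprK. Qed.

Definition pres_one : presented_group := pi [::].
Definition pres_mul (g h : presented_group) : presented_group :=
  pi (repr g ++ repr h).
Definition pres_inv (g : presented_group) : presented_group :=
  pi (winv (repr g)).

Lemma pres_mulA : associative pres_mul.
Proof.
move=> g h k; apply/pi_eqP.
apply: (@WTrans _ (repr g ++ (repr h ++ repr k))).
  exact: WCat (WRefl _) (repr_pi _).
by rewrite catA; apply: WCat (WSym (repr_pi _)) (WRefl _).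
Qed.

Lemma pres_mul1g : left_id pres_one pres_mul.
Proof.
move=> g; rewrite -[RHS]reprK; apply/pi_eqP.
exact: (WCat (repr_pi [::]) (WRefl (repr g))).
Qed.

Lemma pres_mulg1 : right_id pres_one pres_mul.
Proof.
move=> g; rewrite -[RHS]reprK; apply/pi_eqP.
by have := WCat (WRefl (repr g)) (repr_pi [::]); rewrite cats0.
Qed.

Lemma winv_catr (u : word X) : word_eqv (u ++ winv u) [::].
Proof.
elim: u => [|[x b] u IHu]; first exact: WRefl.
rewrite /winv /= rev_cons -/(winv u) -cats1 catA.
apply: WTrans (WCancel x b).
exact: (WCat (WRefl [:: (x, b)]) (WCat IHu (WRefl [:: (x, ~~ b)]))).
Qed.

Lemma winvK : involutive (@winv X).
Proof.
move=> u; rewrite /winv map_rev revK -map_comp -[RHS]map_id.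
by apply: eq_map => -[x b] /=; rewrite negbK.
Qed.

Lemma pres_mulgV : right_inverse pres_one pres_inv pres_mul.
Proof.
move=> g; apply/pi_eqP; apply: WTrans (winv_catr (repr g)).
exact: WCat (WRefl _) (repr_pi _).
Qed.

Lemma pres_mulVg : left_inverse pres_one pres_inv pres_mul.
Proof.
move=> g; apply/pi_eqP; apply: WTrans (winv_catr (winv (repr g))).
by rewrite winvK; apply: WCat (repr_pi _) (WRefl _).
Qed.

HB.instance Definition _ := isGroup.Build presented_group
  pres_mulA pres_mul1g pres_mulg1 pres_mulVg pres_mulgV.

End Presentation.

Definition isomorphic_groups (G H : groupType) : Prop :=
  exists f : {multiplicative G -> H}, bijective f.

Definition sieradski_relator (n : nat) (i : 'I_n) : word 'I_n :=
  wgen i ++ wgen (ordS (ordS i)) ++ winv (wgen (ordS i)).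

Definition sieradski_group (n : nat) : groupType :=
  presented_group (@sieradski_relator n).

(* Graphs have at least one vertex: the empty graph would make the trivial
   group, presented by < | >, a LOG group. *)
Record log_graph := LogGraph {
  log_vertex : finType;
  log_edge : finType;
  log_init : log_edge -> log_vertex;
  log_term : log_edge -> log_vertex;
  log_label : log_edge -> log_vertex;
  log_nonempty : 0 < #|log_vertex|
}.

Definition log_relator (L : log_graph) (e : log_edge L) : word (log_vertex L) :=
  winv (wgen (log_term e)) ++ winv (wgen (log_label e))
    ++ wgen (log_init e) ++ wgen (log_label e).

Definition log_presented_group (L : log_graph) : groupType :=
  presented_group (@log_relator L).

Definition is_log_group (G : groupType) : Prop :=
  exists L : log_graph, isomorphic_groups G (log_presented_group L).

(* Main.v *)
(** Sending all vertices to one generator maps a LOG group onto any cyclic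
group, whereas a homomorphism from S(2,n) to an abelian
group is an n-periodic solution of a_(i+1) = a_i + a_(i+2).  Such a solution
satisfies a_(i+3) = - a_i, so it has period 6, and for values in Z/5 it vanishes
unless 6 divides n.

Conversely, let 6 divide n.  The relations with 3 | i express x_(3j+1) as
x_(3j) x_(3j+2).  With c_(2j) = x_(3j) and c_(2j+1) = x_(3j+2) the remaining
ones become c_i c_(i+1) c_(i+2) = c_(i+1), for i modulo 2n/3, saying that
c_(i+2) is conjugate to the inverse of c_i by c_(i+1).  As 4 divides 2n/3,
inverting the c_i with i = 2, 3 modulo 4 is consistent and turns these into LOG
relations. *)
From HB Require Import structures.
Require Import Defs.
From mathcomp Require Import all_boot.
From mathcomp Require Import ssralg zmodp.
From mathcomp Require Import generic_quotient zify.

Set Implicit Arguments.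
Unset Strict Implicit.
Unset Printing Implicit Defensive.

Import GRing.Theory.

Local Open Scope group_scope.

(** * Homomorphisms, evaluation of words, and the universal property of a presentation *)

Section GroupMorphism.

Variables (G H : groupType) (f : {multiplicative G -> H}).

Lemma multiplicative1 : f 1 = 1.
Proof. by apply: (@mulgI _ (f 1)); rewrite -gmulfM !mulg1. Qed.

Lemma multiplicativeV x : f x^-1 = (f x)^-1.
Proof. by apply: (@mulgI _ (f x)); rewrite -gmulfM !mulgV multiplicative1. Qed.

End GroupMorphism.

Section WordEvaluation.

Variables (X : choiceType) (G : groupType).

Definition eval_word (g : X -> G) (w : word X) : G :=
  \prod_(a <- w) (if a.2 then (g a.1)^-1 else g a.1).

Lemma eval_word_cat g u v : 
  eval_word g (u ++ v) = eval_word g u * eval_word g v.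
Proof. exact: big_cat. Qed.

Lemma eval_word_gen g x : eval_word g (wgen x) = g x.
Proof. by rewrite /eval_word big_seq1. Qed.

Lemma eval_word_inv g u : eval_word g (winv u) = (eval_word g u)^-1.
Proof.
elim: u => [|[x b] u IHu]; first by rewrite /eval_word !big_nil invg1.
rewrite /winv /= rev_cons -/(winv u) -cats1 eval_word_cat IHu.
rewrite /eval_word !big_cons big_nil mulg1 invgM /=.
by case: b; rewrite ?invgK.
Qed.

Lemma eval_word_eqv I (r : I -> word X) g u v :
  (forall i, eval_word g (r i) = 1) -> word_eqv r u v ->
  eval_word g u = eval_word g v.
Proof.
move=> gr; elim=> {u v} //.
- by move=> u v w _ -> _ ->.
- by move=> u u' v v' _ uu' _ vv'; rewrite !eval_word_cat uu' vv'.
- move=> x b; rewrite /eval_word !big_cons big_nil mulg1 /=.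
  by case: b; rewrite /= ?mulVg ?mulgV.
- by move=> i; rewrite gr /eval_word big_nil.
Qed.

End WordEvaluation.

Section UniversalProperty.

Variables (X : choiceType) (I : Type) (r : I -> word X).

Definition pres_gen (x : X) : presented_group r :=
  (\pi_(presented_group r) (wgen x))%qT.

Lemma pi_cat u v :
  (\pi_(presented_group r) (u ++ v) =
   \pi_(presented_group r) u * \pi_(presented_group r) v)%qT.
Proof. by apply/pi_eqP/WSym/WCat; apply: repr_pi. Qed.

Lemma pi_inv u :
  (\pi_(presented_group r) (winv u) = (\pi_(presented_group r) u)^-1)%qT.
Proof.
apply: (@mulgI _ (\pi_(presented_group r) u)%qT).
by rewrite mulgV -pi_cat; apply/pi_eqP/winv_catr.
Qed.

Lemma eval_word_pres_gen w :
  eval_word pres_gen w = (\pi_(presented_group r) w)%qT.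
Proof.
elim: w => [|[x b] w IHw]; first by rewrite /eval_word big_nil.
rewrite -cat1s eval_word_cat pi_cat IHw /eval_word big_seq1 /=.
by case: b => //; congr (_ * _); rewrite /pres_gen -pi_inv.
Qed.

Lemma eval_pres_relator i : eval_word pres_gen (r i) = 1.
Proof. by rewrite eval_word_pres_gen; apply/pi_eqP/WRel. Qed.

(** Von Dyck's theorem: evaluating a representative word is well defined because [g] kills the
    relators. *)
Lemma pres_lift (G : groupType) (g : X -> G) :
    (forall i, eval_word g (r i) = 1) ->
  exists f : {multiplicative presented_group r -> G},
    forall x, f (pres_gen x) = g x.
Proof.
move=> gr; pose f (a : presented_group r) := eval_word g (repr a).
have f_pi w : f (\pi_(presented_group r) w)%qT = eval_word g w.
  by apply: eval_word_eqv gr _; apply: repr_pi.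
have fM : {morph f : a b / a * b}.
  by move=> a b; rewrite -[a]reprK -[b]reprK -pi_cat !f_pi eval_word_cat.
pose fm := isMultiplicative.Build _ _ f fM.
pose F : {multiplicative presented_group r -> G} := HB.pack f fm.
by exists F => x; rewrite /= f_pi eval_word_gen.
Qed.

(** Every element is a word in the generators, so a homomorphism is determined by its values on
    them. *)
Lemma pres_hom_eval (G : groupType)
    (f : {multiplicative presented_group r -> G}) a :
  f a = eval_word (f \o pres_gen) (repr a).
Proof.
rewrite -{1}[a]reprK -eval_word_pres_gen /eval_word.
rewrite (big_morph f (gmulfM (s := f)) (multiplicative1 f)).
by apply: eq_bigr => -[x []] _ //=; rewrite multiplicativeV.
Qed.

Lemma pres_hom_ext (G : groupType)
    (f h : {multiplicative presented_group r -> G}) :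
  (forall x, f (pres_gen x) = h (pres_gen x)) -> f =1 h.
Proof.
move=> fh a; rewrite !pres_hom_eval /eval_word.
by apply: eq_bigr => -[x b] _ /=; rewrite fh.
Qed.

End UniversalProperty.

Lemma presented_isomorphic (X Y : choiceType) (I J : Type)
    (r : I -> word X) (s : J -> word Y)
    (f : {multiplicative presented_group r -> presented_group s})
    (h : {multiplicative presented_group s -> presented_group r}) :
    (forall x, h (f (pres_gen r x)) = pres_gen r x) ->
    (forall y, f (h (pres_gen s y)) = pres_gen s y) ->
  isomorphic_groups (presented_group r) (presented_group s).
Proof.
move=> hf fh; exists f, h.
  exact: (pres_hom_ext (f := h \o f) (h := idfun) hf).
exact: (pres_hom_ext (f := f \o h) (h := idfun) fh).
Qed.

(** * Indices modulo [n], and [n]-periodic sequences on [nat] *)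

Section CyclicIndices.

Variables (n : nat) (n_gt0 : 0 < n).

Definition cyc_ord (i : nat) : 'I_n := Ordinal (ltn_pmod i n_gt0).

Lemma ordS_cyc_ord i : ordS (cyc_ord i) = cyc_ord i.+1.
Proof. by apply: val_inj; rewrite /= -addn1 modnDml addn1. Qed.

Lemma cyc_ord_val (i : 'I_n) : cyc_ord i = i.
Proof. by apply: val_inj; rewrite /= modn_small. Qed.

Lemma cyc_ord_period i : cyc_ord (i + n) = cyc_ord i.
Proof. by apply: val_inj; rewrite /= modnDr. Qed.

End CyclicIndices.

Section Periodic.

Variables (T : Type) (n : nat) (g : nat -> T).
Hypothesis g_period : forall i, g (i + n) = g i.

Lemma periodic_mul i k : g (i + k * n) = g i.
Proof. by elim: k => [|k IHk]; rewrite ?addn0 // mulSn addnCA addnC g_period. Qed.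

Lemma periodic_mod i : g (i %% n) = g i.
Proof. by rewrite [in RHS](divn_eq i n) addnC periodic_mul. Qed.

Lemma periodic_ordS (i : 'I_n) : g (ordS i) = g i.+1.
Proof. exact: periodic_mod. Qed.

Lemma periodic_ordSS (i : 'I_n) : g (ordS (ordS i)) = g i.+2.
Proof.
by rewrite /= periodic_mod -addn1 -periodic_mod modnDml periodic_mod addn1.
Qed.

End Periodic.

(** * Generators and homomorphisms of the Sieradski group *)

Section Sieradski.

Variable n : nat.

Lemma eval_sieradski_relator (G : groupType) (g : 'I_n -> G) i :
  eval_word g (sieradski_relator i) = g i * g (ordS (ordS i)) * (g (ordS i))^-1.
Proof. by rewrite !eval_word_cat eval_word_inv !eval_word_gen mulgA. Qed.

(** Taking the images of the generators as a periodic sequence on [nat] keeps wrap-around out of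
    later index computations. *)
Lemma sieradski_lift (G : groupType) (g : nat -> G) :
    (forall i, g (i + n)%N = g i) ->
    (forall i, g i * g i.+2 = g i.+1) ->
  exists f : {multiplicative sieradski_group n -> G},
    forall i : 'I_n, f (pres_gen _ i) = g i.
Proof.
move=> gn gM; apply: (@pres_lift _ _ _ _ (fun i : 'I_n => g i)) => i.
rewrite eval_sieradski_relator (periodic_ordSS gn) (periodic_ordS gn).
by rewrite gM mulgV.
Qed.

Hypothesis n_gt0 : 0 < n.

Definition sieradski_gen (i : nat) : sieradski_group n :=
  pres_gen _ (cyc_ord n_gt0 i).

Lemma sieradski_genE i :
  sieradski_gen i * sieradski_gen i.+2 = sieradski_gen i.+1.
Proof.
have := eval_pres_relator (@sieradski_relator n) (cyc_ord n_gt0 i).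
rewrite eval_sieradski_relator !ordS_cyc_ord => /(canRL (mulgVK _)).
by rewrite mul1g.
Qed.

End Sieradski.

(** * Inverting half of the generators *)

Section SignTwist.

Variable G : groupType.
Implicit Type c : nat -> G.

(** Positive exactly for [i] congruent to 0 or 1 modulo 4. *)
Definition pos_sign (i : nat) := ~~ odd i./2.

Lemma pos_signSS i : pos_sign i.+2 = ~~ pos_sign i.
Proof. by []. Qed.

Lemma pos_sign_period i k : pos_sign (i + 4 * k) = pos_sign i.
Proof. by rewrite /pos_sign; lia. Qed.

Definition twist c i := if pos_sign i then c i else (c i)^-1.

Lemma twistK c i : twist (twist c) i = c i.
Proof. by rewrite /twist; case: (pos_sign i); rewrite ?invgK. Qed.

Lemma mulg_eq1C (x y : G) : (x * y == 1) = (y * x == 1).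
Proof. by rewrite !mulg_eq1 -eqg_invLR eq_sym. Qed.

(** Indices [i] and [i.+2] have opposite signs, so twisting turns conjugacy to an inverse into plain
    conjugacy. If [c i.+1] is itself inverted, the conjugation runs backwards, hence the exchange of
    the two ends. *)
Lemma twist_log_relation c i :
  let u := if pos_sign i.+1 then i else i.+2 in
  let v := if pos_sign i.+1 then i.+2 else i in
  ((twist c v)^-1 * ((twist c i.+1)^-1 * (twist c u * twist c i.+1)) == 1) =
  (c i * c i.+1 * c i.+2 == c i.+1).
Proof.
rewrite /twist -[RHS]divg_eq1; case: (pos_sign i.+1);
  rewrite /= pos_signSS; case: (pos_sign i); rewrite /= ?invgK -?mulgA //.
(* With both signs negative the two relators coincide. In the remaining cases they agree up to
   cyclic permutation and, when the signs differ, inversion. *)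
- by rewrite mulg_eq1C -!mulgA mulg_eq1C -!mulgA.
- by rewrite -invg_eq1 !invgM !invgK -!mulgA mulg_eq1C -!mulgA.
- by rewrite -invg_eq1 !invgM !invgK [RHS]mulg_eq1C -!mulgA.
Qed.

End SignTwist.

(** * The LOG for the twisted relations *)

Section TwistedCycleLog.

Variables (N : nat) (N_gt0 : 0 < N).

(* The edge [e] carries the relation [twist_log_relation] of index [e]. *)
Definition twisted_cycle_log : log_graph := {|
  log_vertex := 'I_N;
  log_edge := 'I_N;
  log_init e := if pos_sign e.+1 then e else ordS (ordS e);
  log_term e := if pos_sign e.+1 then ordS (ordS e) else e;
  log_label e := ordS e;
  log_nonempty := etrans (congr1 _ (card_ord N)) N_gt0
|}.

Lemma eval_log_relator (G : groupType) (L : log_graph) (g : log_vertex L -> G) e :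
  eval_word g (log_relator e) =
    (g (log_term e))^-1 * ((g (log_label e))^-1 *
      (g (log_init e) * g (log_label e))).
Proof. by rewrite !eval_word_cat !eval_word_inv !eval_word_gen. Qed.

(** As 4 divides [N], the signs are [N]-periodic, so [twist c] is well defined modulo [N] and
    satisfies the edge relations by [twist_log_relation]. *)
Lemma twisted_cycle_log_lift (G : groupType) (c : nat -> G) :
    4 %| N ->
    (forall i, c (i + N)%N = c i) ->
    (forall i, c i * c i.+1 * c i.+2 = c i.+1) ->
  exists f : {multiplicative log_presented_group twisted_cycle_log -> G},
    forall i : 'I_N, f (pres_gen _ i) = twist c i.
Proof.
move=> /dvdnP[k Nk] cN cM.
have tN i : twist c (i + N) = twist c i.
  by rewrite /twist cN Nk mulnC pos_sign_period.
apply: (@pres_lift _ _ _ _ (fun i : 'I_N => twist c i)) => e.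
rewrite (@eval_log_relator _ twisted_cycle_log) /= periodic_mod //.
have /eqP := cM e; rewrite -twist_log_relation => /eqP.
by case: (pos_sign _); rewrite (periodic_ordSS tN).
Qed.

Definition twisted_cycle_gen (i : nat) :
    log_presented_group twisted_cycle_log :=
  pres_gen (@log_relator twisted_cycle_log) (cyc_ord N_gt0 i).

Lemma twisted_cycle_genE i : 4 %| N ->
  let c := twist twisted_cycle_gen in c i * c i.+1 * c i.+2 = c i.+1.
Proof.
move=> /dvdnP[k Nk] c; apply/eqP; rewrite -twist_log_relation !twistK.
have := eval_pres_relator (@log_relator twisted_cycle_log) (cyc_ord N_gt0 i).
rewrite eval_log_relator /= !ordS_cyc_ord.
have -> : pos_sign (i %% N).+1 = pos_sign i.+1.
  rewrite -[in RHS](periodic_mod (g := fun j => pos_sign j.+1) (n := N)) //.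
  by move=> j; rewrite -addSn Nk mulnC pos_sign_period.
by move/eqP; case: (pos_sign i.+1).
Qed.

End TwistedCycleLog.

(** * Passing between the sequences [x] and [c] *)

Section ExplicitIsomorphism.

Variable G : groupType.

Definition sieradski_of_cycle (c : nat -> G) (i : nat) : G :=
  let j := (i %/ 3).*2 in
  match i %% 3 with
  | 0 => c j
  | 1 => c j * c j.+1
  | _ => c j.+1
  end.

(** Enumerates the indices 0, 2, 3, 5, ... not congruent to 1 modulo 3, those of the generators that
    are kept. *)
Definition sieradski_index (i : nat) : nat := i + uphalf i.

(** The list lookup lets a concrete remainder compute; its default 1 is never reached. *)
Lemma sieradski_of_cycle_mod3 c j r : r < 3 ->
  sieradski_of_cycle c (j * 3 + r) =
  nth 1 [:: c j.*2; c j.*2 * c j.*2.+1; c j.*2.+1] r.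
Proof.
move=> r3; rewrite /sieradski_of_cycle divnMDl // modnMDl divn_small // addn0.
by rewrite modn_small //; case: r r3 => [|[|[]]].
Qed.

Lemma sieradski_index_double j : sieradski_index j.*2 = (j * 3 + 0)%N.
Proof. by rewrite /sieradski_index; lia. Qed.

Lemma sieradski_index_doubleS j : sieradski_index j.*2.+1 = (j * 3 + 2)%N.
Proof. by rewrite /sieradski_index; lia. Qed.

Lemma sieradski_of_cycleK c i : sieradski_of_cycle c (sieradski_index i) = c i.
Proof.
rewrite -[i]odd_double_half; case: (odd i).
  by rewrite add1n sieradski_index_doubleS sieradski_of_cycle_mod3.
by rewrite add0n sieradski_index_double sieradski_of_cycle_mod3.
Qed.

(** For [i = 3j] this is the definition of the middle term; for [3j+1] and [3j+2] it is the relation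
    of [c] at [2j] and [2j+1]. *)
Lemma sieradski_of_cycleE c :
    (forall i, c i * c i.+1 * c i.+2 = c i.+1) ->
  let x := sieradski_of_cycle c in forall i, x i * x i.+2 = x i.+1.
Proof.
move=> cM x i; rewrite (divn_eq i 3) /x; set j := i %/ 3.
have : i %% 3 < 3 by rewrite ltn_mod.
case: (i %% 3) => [|[|[|//]]] _.
- by rewrite -!addnS !sieradski_of_cycle_mod3.
- have -> : (j * 3 + 1).+2 = (j.+1 * 3 + 0)%N by lia.
  by rewrite -addnS !sieradski_of_cycle_mod3 //= doubleS cM.
- have -> : (j * 3 + 2).+2 = (j.+1 * 3 + 1)%N by lia.
  have -> : (j * 3 + 2).+1 = (j.+1 * 3 + 0)%N by lia.
  by rewrite !sieradski_of_cycle_mod3 //= doubleS mulgA cM.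
Qed.

(** With [h] the index of [c i], the product is [x h * x h.+2 * x h.+3] for even [i] and
    [x h * x h.+1 * x h.+3] for odd [i]. Two relations of [x] collapse it, bracketed from the left
    or from the right respectively. *)
Lemma cycle_of_sieradskiE (x : nat -> G) :
    (forall i, x i * x i.+2 = x i.+1) ->
  let c := x \o sieradski_index in forall i, c i * c i.+1 * c i.+2 = c i.+1.
Proof.
move=> xM c i; rewrite /c /=; set h := sieradski_index i.
have -> : sieradski_index i.+2 = h.+3 by rewrite /h /sieradski_index; lia.
have -> : sieradski_index i.+1 = if odd i then h.+1 else h.+2.
  by rewrite /h /sieradski_index; case: ifP; lia.
by case: (odd i); rewrite -?mulgA ?xM // mulgA !xM.
Qed.

End ExplicitIsomorphism.

(** * Sufficiency: the two groups are isomorphic when 6 divides [n] *)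

Lemma sieradski_group_is_log n :
  0 < n -> 6 %| n -> is_log_group (sieradski_group n).
Proof.
(* [N] is [2n/3], the number of generators left after elimination. *)
move=> n_gt0 /dvdnP[k nE]; pose N := (4 * k)%N; have N_gt0 : 0 < N by lia.
have N4 : 4 %| N by rewrite /N dvdn_mulr.
pose C := twisted_cycle_gen N_gt0; pose c := twist C.
pose x := sieradski_gen n_gt0.
have cN i : c (i + N) = c i.
  by rewrite /c /twist pos_sign_period /C /twisted_cycle_gen cyc_ord_period.
have xn i : x (i + n) = x i by rewrite /x /sieradski_gen cyc_ord_period.
have cM i : c i * c i.+1 * c i.+2 = c i.+1 by apply: twisted_cycle_genE.
have xM i : x i * x i.+2 = x i.+1 by apply: sieradski_genE.
have gn i : sieradski_of_cycle c (i + n) = sieradski_of_cycle c i.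
  rewrite (divn_eq i 3); have i3 : i %% 3 < 3 by rewrite ltn_mod.
  have -> : (i %/ 3 * 3 + i %% 3 + n = (i %/ 3 + 2 * k) * 3 + i %% 3)%N by lia.
  rewrite !sieradski_of_cycle_mod3 //.
  have -> : ((i %/ 3 + 2 * k).*2 = (i %/ 3).*2 + N)%N by lia.
  by rewrite -addSn !cN.
have hn i : (x \o sieradski_index) (i + N)%N = (x \o sieradski_index) i.
  rewrite /= -[RHS]xn; congr x; rewrite /sieradski_index; lia.
have [f fE] := sieradski_lift gn (sieradski_of_cycleE cM).
have [h hE] := twisted_cycle_log_lift N_gt0 N4 hn (cycle_of_sieradskiE xM).
have fx i : f (x i) = sieradski_of_cycle c i.
  by rewrite /x /sieradski_gen fE (periodic_mod gn).
(* [h] is given on the LOG generators [C], with twisted values; twisting once more gives its values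
   on [c]. *)
have hc i : h (c i) = x (sieradski_index i).
  have hC j : h (C j) = twist (x \o sieradski_index) j.
    rewrite hE /=; apply: (periodic_mod (g := twist _)) => {}j.
    by rewrite /twist hn pos_sign_period.
  rewrite -[RHS](twistK (x \o sieradski_index)) /c /twist.
  by case s: (pos_sign i); rewrite ?multiplicativeV hC /twist s.
exists (twisted_cycle_log N_gt0).
apply: (presented_isomorphic (f := f) (h := h)) => i.
  transitivity (x i); last by rewrite /x /sieradski_gen cyc_ord_val.
  rewrite fE.
  rewrite (divn_eq i 3); have i3 : i %% 3 < 3 by rewrite ltn_mod.
  rewrite sieradski_of_cycle_mod3 //.
  case: (i %% 3) i3 => [|[|[|//]]] _ /=.
  - by rewrite hc sieradski_index_double.
  (* The eliminated generator is recovered from its defining relation. *)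
  - rewrite gmulfM !hc sieradski_index_double sieradski_index_doubleS.
    by rewrite addn0 addn2 xM addn1.
  - by rewrite hc sieradski_index_doubleS.
transitivity (C i); last by rewrite /C /twisted_cycle_gen cyc_ord_val.
rewrite hE -[RHS]twistK -/c /twist.
by case: (pos_sign i); rewrite ?multiplicativeV /= fx sieradski_of_cycleK.
Qed.

(** * Necessity: homomorphisms to the cyclic group of order 5 *)

(** Conjugating [a] by itself changes nothing, so the constant assignment kills every relator. *)
Lemma pres_hom_log (L : log_graph) (G : groupType) (a : G) :
  exists f : {multiplicative log_presented_group L -> G},
    forall v, f (pres_gen _ v) = a.
Proof.
apply: (@pres_lift _ _ _ _ (fun=> a)) => e.
by rewrite eval_log_relator mulKg mulVg.
Qed.

(** [s] is one period of the recurrence and its return to [u]. A shift by [r] forces [u] to be 0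
    once 2 and 3 are invertible ([r = 3] gives [2u = 0], [r = 2] gives [3u = 0]), which is why the
    modulus is 5. The proof enumerates all cases. *)
Lemma sieradski_recurrence5 (u v : 'I_5) r :
  let s := [:: u; v; v - u; - u; - v; u - v; u]%R in
  0 < r < 6 -> nth 0%R s r = u -> nth 0%R s r.+1 = v -> u = 0%R.
Proof.
move=> s r_bounds /(congr1 val) su /(congr1 val) sv; apply: val_inj.
move: su sv; rewrite {}/s.
case: r r_bounds => [|[|[|[|[|[|//]]]]]] //= _;
  case: u => -[|[|[|[|[|//]]]]] //= ?;
  by case: v => -[|[|[|[|[|//]]]]].
Qed.

(** The group law on ['I_5] is addition, so the unit [1] here is [0%R]. *)
Lemma sieradski_hom_trivial n (f : {multiplicative sieradski_group n -> 'I_5}) :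
  0 < n -> ~~ (6 %| n) -> forall g, f g = 1.
Proof.
move=> n_gt0 n6; pose a i := f (sieradski_gen n_gt0 i).
have aE i : (a i + a i.+2 = a i.+1)%R.
  by rewrite /a -(sieradski_genE n_gt0 i) gmulfM.
have aSS i : a i.+2 = (a i.+1 - a i)%R by rewrite -[a i.+1]aE addrC addKr.
have a3 i : a (i + 3)%N = (- a i)%R.
  by rewrite addn3 !aSS addrAC subrr add0r.
have a6 i : a (i + 6)%N = a i.
  by rewrite -[6]/(3 + 3)%N addnA !a3 opprK.
(* Periods 6 and [n] together give the period [n %% 6], nonzero by assumption. *)
have an i : a (i + n %% 6)%N = a i.
  rewrite -(periodic_mul a6 _ (n %/ 6)) -addnA [(_ %% _ + _)%N]addnC -divn_eq.
  by rewrite /a /sieradski_gen cyc_ord_period.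
have a0 i : a i = 0%R.
  have n_mod6 : 0 < n %% 6 < 6 by rewrite lt0n n6 ltn_mod.
  (* The bound 7 is needed since the recurrence lemma also reads position [r.+1], up to 6. *)
  have sE j : j < 7 ->
      nth 0%R [:: a i; a i.+1; a i.+1 - a i; - a i; - a i.+1;
                 a i - a i.+1; a i]%R j = a (i + j)%N.
    case: j => [|[|[|[|[|[|[|//]]]]]]] _ /=.
    - by rewrite addn0.
    - by rewrite addn1.
    - by rewrite addn2 aSS.
    - by rewrite a3.
    - by rewrite -addSnnS a3.
    - by rewrite -[5]/(2 + 3)%N addnA a3 addn2 aSS opprB.
    - by rewrite a6.
  apply: (sieradski_recurrence5 (v := a i.+1) n_mod6).
    by rewrite sE ?an //; lia.
  by rewrite sE -?addSnnS ?an //; lia.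
move=> g; rewrite pres_hom_eval /eval_word big1 // => -[i b] _ /=.
have -> : f (pres_gen _ i) = 1.
  by rewrite -[i](cyc_ord_val n_gt0); apply: a0.
by case: b; rewrite ?invg1.
Qed.

Theorem corollary5p2 (n : nat) (hn : 1 <= n) :
  is_log_group (sieradski_group n) <-> 6 %| n.
Proof.
split=> [[L [f [h _ fh]]]|]; last exact: sieradski_group_is_log.
apply: contraT => n6.
have /card_gt0P[v _] := log_nonempty L.
(* The ring unit [1%R] is not the group unit of ['I_5], so [p] is nontrivial at the vertex [v],
   while [p \o f] must be trivial. *)
have [p pE] := pres_hom_log L (1%R : 'I_5).
have := sieradski_hom_trivial (p \o f) hn n6 (h (pres_gen _ v)).
by rewrite /= fh pE.
Qed.
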